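(* Let $G$ be a finite group and $k$ a positive integer. Then $s_k(G)=|G|-2$ if and only if one of the following holds. (a) $k$ is odd and $G\cong H\times C_2$, where $H$ is a group of exponent dividing $k$. (In this case $G$ contains a unique involution $g$, and $G\setminus\{1,g\}$ is $k$-power-avoiding.) (b) $k\equiv 2 \pmod 3$ and $G$ is cyclic of order $3$. (In this case, for any non-identity element $g\in G$, the set $\{g\}$ is a $k$-power-avoiding set of size $|G|-2$.) (c) $k\equiv 2\pmod 6$ and $G$ is dihedral of order $6$. (In this case, if $g$ is any element of order $3$ in $G$, then $G\setminus\{1,g\}$ is $k$-power-avoiding.) (d) $k$ is even, $G$ is a central extension of a group $H$, of exponent dividing $k$, by $C_2$ (that is, $G$ has a central subgroup $Z$ of order $2$ with $G/Z\cong H$), and $\exp(G)$ does not divide $k$. (In this case, there is a central subgroup $\{1,g\}$ of order $2$ in $G$ such that $G\setminus\{1,g\}$ is $k$-power-avoiding.)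
   Context: Let $G$ be a finite group and $k$ a positive integer. A subset $X\subseteq G$ is called $k$-power-avoiding if $\{g,g^k\}\not\subseteq X$ for every $g\in G$ (in particular, $X$ contains no element $g$ with $g^k=g$). Define $s_k(G)=\max\{|X| : X\subseteq G \text{ is } k\text{-power-avoiding}\}$. $C_n$ denotes the cyclic group of order $n$, and $\exp(G)$ the exponent of $G$. *)

(* Defs.v *)
From mathcomp Require Import all_boot all_order all_fingroup all_algebra.
From mathcomp Require Import all_solvable.
Set Implicit Arguments.
Unset Strict Implicit.
Unset Printing Implicit Defensive.
Local Open Scope group_scope.

(* Only subsets of G are considered: the condition g \in G alone would not
   constrain the elements of X outside G. *)
Definition power_avoiding (gT : finGroupType) (G : {group gT}) (k : nat)
    (X : {set gT}) : bool :=
  (X \subset G) && [forall g in G, ~~ ([set g; g ^+ k] \subset X)].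

(* Every G has a k-power-avoiding subset, namely set0, so this maximum is taken
   over a nonempty family. *)
Definition power_avoiding_max (gT : finGroupType) (G : {group gT}) (k : nat) :
    nat :=
  \max_(X : {set gT} | power_avoiding G k X) #|X|.

(* Zp 2 is the additive group of integers modulo 2. *)
Definition odd_direct_product_case (gT : finGroupType) (G : {group gT})
    (k : nat) : Prop :=
  odd k /\
  exists (hT : finGroupType) (H : {group hT}),
    exponent H %| k /\ G \isog setX H (Zp 2).

Definition cyclic3_case (gT : finGroupType) (G : {group gT}) (k : nat) : Prop :=
  [/\ k = 2 %[mod 3], cyclic G & #|G| = 3].

Definition dihedral6_case (gT : finGroupType) (G : {group gT}) (k : nat) :
    Prop :=
  k = 2 %[mod 6] /\ G \isog 'D_6.

Definition central_extension_case (gT : finGroupType) (G : {group gT})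
    (k : nat) : Prop :=
  [/\ ~~ odd k,
      exists (hT : finGroupType) (H : {group hT}) (Z : {group gT}),
        [/\ exponent H %| k, Z \subset 'Z(G), #|Z| = 2 & G / Z \isog H]
    & ~~ (exponent G %| k)].

(* Main.v *)
Require Import Defs.
From mathcomp Require Import all_boot all_order all_fingroup all_algebra.
From mathcomp Require Import all_solvable.
Set Implicit Arguments.
Unset Strict Implicit.
Unset Printing Implicit Defensive.
Local Open Scope group_scope.

(* The identity lies in no power-avoiding set, so the maximum is |G| - 2 exactly
   when exp(G) does not divide k and some G \ {1, g} is avoiding, i.e. x^k lies in
   {1, g} for every x <> g.  What happens is decided by g^k.
   If g^k = g, then g is a central involution and k is odd; every 2-element lies
   in {1, g}, so Schur-Zassenhaus splits off <g>: case (a).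
   If g^k = 1, some x has x^k = g, which forces g to be a central involution and
   k to be even: case (d).
   Otherwise g^k = g^-1; applying the condition to g^2 gives g^3 = 1, and the only
   elements of order 3 are g and g^-1.  Applying it to c, cg and cg^2, for c
   centralising g, shows that <g> is its own centraliser, so |G| divides 6 and
   G is cyclic of order 3 or dihedral of order 6: cases (b) and (c). *)

Lemma expg_mod_cardG (gT : finGroupType) (G : {group gT}) (x : gT) m n :
  x \in G -> m = n %[mod #|G|] -> x ^+ m = x ^+ n.
Proof.
move=> Gx eq_mn.
have expE i : x ^+ i = x ^+ (i %% #|G|).
  by rewrite {1}(divn_eq i #|G|) mulnC expgD expgM expg_cardG // expg1n mul1g.
by rewrite expE eq_mn -expE.
Qed.

(** * Avoiding sets through their complements, and the size of the largest one *)

Section Avoiding.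

Variables (gT : finGroupType) (G : {group gT}) (k : nat).
Implicit Types (g x : gT) (X : {set gT}).

Lemma power_avoiding_setDP X :
  reflect (forall x, x \in G -> (x \in X) || (x ^+ k \in X))
          (power_avoiding G k (G :\: X)).
Proof.
rewrite /power_avoiding subsetDl /=.
apply: (iffP forall_inP) => avX x Gx; have := avX x Gx;
  rewrite subUset !sub1set !inE Gx groupX // !andbT ?negb_and ?negbK //.
Qed.

Lemma power_avoiding_notin1 X : power_avoiding G k X -> 1 \notin X.
Proof.
case/andP=> _ /forall_inP/(_ 1 (group1 G)).
by rewrite expg1n subUset andbb sub1set.
Qed.

(** This settles when the a priori bound |G| - 1 is attained, since an avoiding set always omits
    1. *)
Lemma power_avoiding_setD1 : power_avoiding G k (G :\: [set 1]) = (exponent G %| k).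
Proof.
apply/power_avoiding_setDP/exponentP => avG x Gx.
  have := avG x Gx; rewrite !inE => /orP[] /eqP // ->.
  by rewrite expg1n.
by rewrite avG // !inE eqxx orbT.
Qed.

(** An avoiding set lies in [G^#], and is smaller than it unless exp(G) divides k. The equation is
    additive because truncated subtraction would let the trivial group satisfy it. *)
Lemma power_avoiding_maxE :
  power_avoiding_max G k + 2 = #|G| <->
  ~~ (exponent G %| k) /\
  exists g, [/\ g \in G, g != 1 & power_avoiding G k (G :\: [set 1; g])].
Proof.
have leM X : power_avoiding G k X -> #|X| <= power_avoiding_max G k.
  by move=> avX; rewrite /power_avoiding_max (leq_bigmax_cond _ avX).
split=> [maxG | [expG [g [Gg g1 avg]]]].
  split.
    apply/negP; rewrite -power_avoiding_setD1 => /leM.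
    have := cardsD1 1 G; rewrite group1 -maxG addn2 add1n => -[<-].
    by rewrite ltnn.
  (* A nonempty family attains its maximum at some X; the complement of X then has two elements, one
     of them 1. *)
  have ne0: 0 < #|[pred X | power_avoiding G k X]|.
    apply/card_gt0P; exists set0; rewrite inE /power_avoiding sub0set /=.
    by apply/forall_inP=> x _; rewrite subUset sub1set inE.
  have [X avX defM] := eq_bigmax_cond (fun X : {set gT} => #|X|) ne0.
  rewrite inE in avX.
  have sXG : X \subset G by case/andP: avX.
  have cX: #|G :\: X| = 2.
    have := cardsID X G.
    by rewrite (setIidPr sXG) -maxG /power_avoiding_max defM => /addnI.
  have X1 : 1 \in G :\: X by rewrite inE group1 (power_avoiding_notin1 avX).
  have [g g1 defX] : exists2 g, g != 1 & G :\: X = [set 1; g].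
    move/eqP/cards2P: cX X1 => [x [y [nxy ->]]]; rewrite !inE.
    case/orP=> /eqP e; [exists y | exists x]; rewrite ?e //.
    - by rewrite eq_sym.
    - by rewrite setUC.
  exists g; split=> //.
    have: g \in G :\: X by rewrite defX !inE eqxx orbT.
    by case/setDP.
  by rewrite -defX setDDr setDv set0U (setIidPr sXG).
have cG : #|G :\: [set 1; g]| + 2 = #|G|.
  rewrite -(cardsID [set 1; g] G) addnC; congr (_ + _)%N.
  rewrite (setIidPr _) ?cards2 1?eq_sym ?g1 //.
  by apply/subsetP=> x /set2P[] ->.
apply/eqP; rewrite eqn_leq; apply/andP; split; last first.
  by rewrite -cG leq_add2r leM.
rewrite -cG leq_add2r; apply/bigmax_leqP=> X avX.
have [sXG _] := andP avX.
have sX1 : X \subset G^# by rewrite subsetD1 sXG power_avoiding_notin1.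
have cG1 : #|G^#| = #|G :\: [set 1; g]|.+1.
  by apply: succn_inj; have := cardsD1 1 G; rewrite group1 -cG addn2 => ->.
have [/eqP eqX | neqX] := boolP (X == G^#).
  by case/negP: expG; rewrite -power_avoiding_setD1 -eqX.
by rewrite -ltnS -cG1 proper_card // properEneq neqX.
Qed.

End Avoiding.

(** An element x of order 3 and an involution y generate a group of order 6, and y acts on the index
    2 subgroup <x>; if G is not abelian this action is inversion, which is the dihedral
    presentation. *)
Lemma dihedral6P (gT : finGroupType) (G : {group gT}) :
  reflect (#|G| = 6 /\ ~~ abelian G) (G \isog 'D_6).
Proof.
apply: (iffP idP) => [isoG | [oG nabG]].
  rewrite (card_isog isoG) (isog_abelian isoG) (@card_dihedral 3) //.
  split=> //; apply/negP=> cDD.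
  have := @Grp_dihedral 3 isT _ [set: 'D_6]; rewrite homg_refl => /esym.
  case/existsP=> -[x y] /= /eqP[defD x3 y2 xy].
  have: x ^ y = x by rewrite /conjg (centsP cDD x _ y) ?inE // mulKg.
  rewrite xy => xV.
  have x1 : x = 1.
    have xx : x * x = 1 by rewrite -{1}xV mulVg.
    by move: x3; rewrite !expgS expg0 mulg1 xx mulg1.
  have := @card_dihedral 3 isT; rewrite -defD x1 cycle1 joing1G -orderE => oy.
  by have := order_dvdn y 2; rewrite y2 eqxx oy.
have [dv3 dv2] : 3 %| #|G| /\ 2 %| #|G| by rewrite oG.
have [[x Gx ox] [y Gy oy]] := (Cauchy (isT : prime 3) dv3, Cauchy (isT : prime 2) dv2).
have sxG : <[x]> \subset G by rewrite cycle_subG.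
have nxG : <[x]> <| G.
  by rewrite index2_normal // -divgS // oG -orderE ox.
have defG : <[x]> <*> <[y]> = G.
  apply/eqP; rewrite eqEcard join_subG !cycle_subG Gx Gy oG /=.
  rewrite norm_joinEr ?cycle_subG ?(subsetP (normal_norm nxG)) //.
  by rewrite coprime_cardMg -?orderE ox oy.
have xy : x ^ y = x^-1.
  have: x ^ y \in <[x]> by rewrite memJ_norm ?cycle_id // (subsetP (normal_norm nxG)).
  case/cycleP=> i xy.
  (* Exponent 0 would make x trivial and exponent 1 would make G abelian, so 2 remains. *)
  have xE : x ^+ i = x ^+ (i %% 3) by rewrite -ox expg_mod_order.
  have: i %% 3 < 3 by rewrite ltn_mod.
  move: xE; case: (i %% 3) => [|[|[|//]]] xE _.
  - move/eqP: xy; rewrite xE expg0 conjg_eq1 => /eqP x1.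
    by move: ox; rewrite x1 order1.
  - case/negP: nabG; rewrite -defG abelianY !cycle_abelian /=.
    by apply: cents_cycle; apply/commute_sym/commgP/conjg_fixP; rewrite xy xE.
  - by rewrite xy xE; apply/esym/eqP; rewrite eq_invg_mul -expgS -ox expg_order.
apply/(isoGrpP _ (@Grp_dihedral 3 isT)); split; first by rewrite oG card_dihedral.
apply/existsP; exists (x, y); rewrite /= -ox -oy !expg_order xy defG.
by rewrite !eqxx.
Qed.

(** * The structure of G forced by an avoiding set G \ {1, g} *)

Section TwoPointComplement.

Variables (gT : finGroupType) (G : {group gT}) (k : nat) (g : gT).
Hypotheses (Gg : g \in G) (g_neq1 : g != 1).

Lemma powers_in_pair_avoiding :
  (forall x, x \in G -> x ^+ k \in [set 1; g]) ->
  power_avoiding G k (G :\: [set 1; g]).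
Proof.
by move=> pwG; apply/power_avoiding_setDP => x Gx; rewrite pwG // orbT.
Qed.

Section Avoiding.

Hypothesis avg : power_avoiding G k (G :\: [set 1; g]).

(** The other exempt element, x = 1, satisfies the conclusion anyway. *)
Lemma avoiding_powers x : x \in G -> x != g -> x ^+ k \in [set 1; g].
Proof.
move=> Gx xg; have /power_avoiding_setDP/(_ x Gx) := avg.
case/orP=> //; rewrite !inE (negPf xg) orbF => /eqP->.
by rewrite expg1n eqxx.
Qed.

(** The inverse of g is also its own k-th power; were it not g, it would have to lie in {1, g}. *)
Lemma avoiding_fixed : g ^+ k = g -> #[g] = 2 /\ odd k.
Proof.
move=> gk.
have og : #[g] = 2.
  apply: nt_prime_order => //.
  have [ggV | gVg] := eqVneq g^-1 g.
    by apply/eqP; rewrite expgS expg1 -eq_invg_mul ggV.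
  have := avoiding_powers (groupVr Gg) gVg.
  by rewrite expgVn gk !inE invg_eq1 (negPf g_neq1) (negPf gVg).
split=> //; apply: contraNT g_neq1 => ek.
by rewrite -gk -order_dvdn og dvdn2.
Qed.

(** Here g is a k-th power x^k. The inverse and the conjugates of x are not g, so their k-th powers,
    which are nontrivial, equal g: thus g is its own inverse and is central. *)
Lemma avoiding_trivial :
  ~~ (exponent G %| k) -> g ^+ k = 1 ->
  [/\ #[g] = 2, g \in 'Z(G) & ~~ odd k].
Proof.
move=> expG gk.
have [x Gx xk] : exists2 x, x \in G & x ^+ k = g.
  have [/exists_inP[x Gx /eqP xk] | /exists_inPn noroot] :=
    boolP [exists x in G, x ^+ k == g]; first by exists x.
  case/negP: expG; apply/exponentP=> x Gx.
  have [-> // | xg] := eqVneq x g.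
  have := avoiding_powers Gx xg; rewrite !inE (negPf (noroot x Gx)) orbF.
  by move/eqP.
have conj_neq y z : z ^+ k != 1 -> z ^ y != g.
  apply: contra => /eqP zy; rewrite -(conjg_eq1 _ y) conjXg zy.
  by rewrite gk.
have og : #[g] = 2.
  apply: nt_prime_order => //; apply/eqP; rewrite expgS expg1 -eq_invg_mul.
  have xVg : x^-1 != g.
    apply: contra g_neq1 => /eqP e.
    by rewrite -xk -[x]invgK e expgVn gk invg1.
  have := avoiding_powers (groupVr Gx) xVg.
  by rewrite expgVn xk !inE invg_eq1 (negPf g_neq1).
split=> //; last by rewrite -dvdn2 -og order_dvdn gk.
apply/centerP; split=> // y Gy; apply/commgP/conjg_fixP.
have := avoiding_powers (groupJ Gx Gy) (conj_neq y x _).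
rewrite xk g_neq1 => /(_ isT).
by rewrite -conjXg xk !inE conjg_eq1 (negPf g_neq1) => /eqP.
Qed.

Section Moved.

Hypothesis gk_moved : g ^+ k \notin [set 1; g].

(** An involution is sent to itself or to 1 by any power, so g^-1 differs from g and its k-th power
    lies in {1, g}; the value 1 would give g^k = 1. *)
Lemma moved_powerE : g ^+ k = g^-1.
Proof.
have [ggV | gVg] := eqVneq g^-1 g.
  have g2 : g ^+ 2 = 1 by apply/eqP; rewrite expgS expg1 -eq_invg_mul ggV.
  case/negP: gk_moved.
  rewrite (divn_eq k 2) expgD mulnC expgM g2 expg1n mul1g modn2.
  by case: (odd k); rewrite !inE eqxx ?orbT.
have := avoiding_powers (groupVr Gg) gVg.
by rewrite expgVn !inE => /orP[] /eqP e; move: gk_moved; rewrite -[g ^+ k]invgK e ?invg1 !inE ?eqxx.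
Qed.

(** The k-th power of g^2 is g^-2. It cannot be 1, since then g^k = g^-1 = g; so it is g. *)
Lemma moved_order : #[g] = 3.
Proof.
apply: nt_prime_order => //.
have g2g : g ^+ 2 != g by rewrite expgS expg1 -{3}[g]mulg1 (inj_eq (mulgI _)).
have := avoiding_powers (groupX 2 Gg) g2g.
rewrite -expgM mulnC expgM moved_powerE !inE => /orP[] /eqP.
  move/eqP; rewrite expgVn invg_eq1 => /eqP g2.
  have gV : g^-1 = g by apply/eqP; rewrite eq_invg_mul -{2}[g]expg1 -expgS g2.
  by move: gk_moved; rewrite moved_powerE gV !inE eqxx orbT.
by rewrite -{2}[g]invgK; move=> e; rewrite expgS -[g ^+ 2]invgK -expgVn e invgK mulgV.
Qed.

Lemma moved_mod3 : k = 2 %[mod 3].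
Proof.
apply/eqP; rewrite -moved_order -eq_expg_mod_order moved_powerE.
by rewrite eq_invg_mul -expgS -{1}moved_order expg_order.
Qed.

Lemma moved_order3 x : x \in G -> #[x] = 3 -> x \in [set g; g^-1].
Proof.
move=> Gx ox; have [-> | xg] := eqVneq x g; first by rewrite !inE eqxx.
have := avoiding_powers Gx xg.
have -> : x ^+ k = x ^+ 2.
  by apply/eqP; rewrite eq_expg_mod_order ox; apply/eqP/moved_mod3.
have -> : x ^+ 2 = x^-1.
  by apply/esym/eqP; rewrite eq_invg_mul -expgS -ox expg_order.
rewrite !inE invg_eq1 -order_eq1 ox /=.
by move/eqP <-; rewrite invgK eqxx orbT.
Qed.

(** If c centralises g and lies outside <g>, no c g^i is g, so the three distinct elements c^k g^-i
    (i = 0, 1, 2) would all lie in the pair {1, g}. *)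
Lemma moved_cent1 : 'C_G[g] = <[g]>.
Proof.
apply/eqP; rewrite eqEsubset andbC cycle_subG inE Gg cent1id /=.
apply/subsetP=> c /setIP[Gc /cent1P cg]; apply: contraT => cNg.
have cgi i : c * g ^+ i != g.
  apply: contra cNg => /eqP e.
  by rewrite -(mulgK (g ^+ i) c) e groupM ?groupV ?mem_cycle ?cycle_id.
have pw i : c ^+ k * (g ^+ i)^-1 \in [set 1; g].
  have := avoiding_powers (groupM Gc (groupX i Gg)) (cgi i).
  rewrite expgMn; last exact: commuteX.
  by rewrite -expgM mulnC expgM moved_powerE expgVn.
have gV : g^-1 = g ^+ 2.
  by apply/eqP; rewrite eq_invg_mul -expgS -moved_order expg_order.
have gg : g * g = g^-1 by rewrite gV expgS expg1.
move: (pw 2%N) (pw 1%N) (pw 0%N).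
rewrite expg0 invg1 mulg1 expg1 -gV invgK => p2 p1 /set2P[] ck.
  move: p1 gk_moved; rewrite ck mul1g moved_powerE.
  by move=> ->.
move: p2 gk_moved; rewrite ck gg moved_powerE.
by move=> ->.
Qed.

(** The conjugates of g have order 3, so there are at most two; their number is the index of <g>,
    its own centraliser, whence |G| is 3 or 6. *)
Lemma moved_cases :
  cyclic3_case G k \/ dihedral6_case G k.
Proof.
have clg : g ^: G \subset [set g; g^-1].
  apply/subsetP=> _ /imsetP[x Gx ->].
  by rewrite moved_order3 ?groupJ // orderJ moved_order.
have := subset_leq_card clg; rewrite -index_cent1 moved_cent1 cards2.
have sgG : <[g]> \subset G by rewrite cycle_subG.
have := Lagrange sgG; rewrite -orderE moved_order.
case: (#|G : <[g]>|) (indexg_gt0 G <[g]>) => [//|[|[|m]]] _ oG; last first.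
- by case: (g == g^-1).
- move=> _; right.
  have dv2 : 2 %| #|G| by rewrite -oG.
  have [y Gy oy] := Cauchy (isT : prime 2) dv2.
  (* The k-th power of an involution y is 1 or g, and g, of order 3, is not a power of y. *)
  have ek : ~~ odd k.
    have yg : y != g by apply/eqP=> e; move: moved_order; rewrite -e oy.
    have /set2P[/eqP | yk] := avoiding_powers Gy yg.
      by rewrite -order_dvdn oy dvdn2.
    have /eqP := moved_order; rewrite -yk; have := orderXdvd y k.
    by rewrite oy; case: #[_] => [|[|[|[|]]]].
  split.
    have /eqP := moved_mod3; move: ek => k2 k3; apply/eqP.
    rewrite (chinese_remainder (isT : coprime 2 3)) k3 andbT.
    by rewrite modn2 (negPf k2).
  apply/dihedral6P; split=> //; apply/negP=> abG.
  have := moved_cent1; rewrite (setIidPl _); last first.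
    by rewrite sub_cent1 (subsetP abG).
  by move/(congr1 (fun A : {set gT} => #|A|)); rewrite -oG -orderE moved_order.
- move=> _; left; split; [exact: moved_mod3 | | by rewrite -oG].
  by apply: prime_cyclic; rewrite -oG.
Qed.

End Moved.

End Avoiding.

End TwoPointComplement.

(** * Avoiding sets obtained from each of the four cases *)

Lemma cycle3_sqr (gT : finGroupType) (g x : gT) :
  #[g] = 3 -> x \in <[g]> -> (x == g) || (x ^+ 2 \in [set 1; g]).
Proof.
move=> og /cyclePmin[i]; rewrite og => lti ->{x}.
case: i lti => [|[|[|//]]] _; rewrite !inE ?expg0 ?expg1n ?expg1 ?eqxx ?orbT //.
by rewrite -expgM (expgD g 3 1) -og expg_order mul1g expg1 eqxx !orbT.
Qed.

Lemma expg_pair (aT bT : finGroupType) (a : aT) (b : bT) n :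
  (a, b) ^+ n = (a ^+ n, b ^+ n).
Proof. by elim: n => // n IHn; rewrite !expgS IHn. Qed.

Lemma Z2_cases (b : 'Z_2) : b = 1 \/ b = Zp1.
Proof.
by case: b => [[|[|//]] ltb]; [left | right]; apply: val_inj.
Qed.

Section Converse.

Variables (gT : finGroupType) (G : {group gT}) (k : nat).

Lemma cyclic3_avoiding g :
  cyclic3_case G k -> g \in G -> g != 1 ->
  #[g] = 3 /\ power_avoiding G k (G :\: [set 1; g]).
Proof.
case=> k2 _ oG Gg g1.
have og : #[g] = 3.
  by apply: nt_prime_order => //; rewrite -oG expg_cardG.
have defG : <[g]> = G :> {set gT}.
  by apply/eqP; rewrite eqEcard cycle_subG Gg -orderE oG og.
split=> //; apply/power_avoiding_setDP=> x Gx.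
rewrite (expg_mod_cardG (n := 2) Gx) ?oG // in_set2 -orbA; apply/orP; right.
by rewrite cycle3_sqr ?defG.
Qed.

(** Since k is 2 modulo |G|, k-th powers are squares. Outside <g> every element is an involution: a
    second subgroup of order 3 would give a product of 9 elements, and an element of order 6 would
    make G cyclic. *)
Lemma dihedral6_avoiding g :
  dihedral6_case G k -> g \in G -> #[g] = 3 ->
  power_avoiding G k (G :\: [set 1; g]).
Proof.
case=> k2 /dihedral6P[oG nabG] Gg og; apply/power_avoiding_setDP=> x Gx.
rewrite (expg_mod_cardG (n := 2) Gx) ?oG // in_set2 -orbA; apply/orP; right.
have [gx | gNx] := boolP (x \in <[g]>); first exact: cycle3_sqr.
have := order_dvdG Gx; rewrite oG.
have : #[x] <= 6 by rewrite -oG dvdn_leq ?order_dvdG.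
have := erefl #[x]; case: {2 3 4}#[x] => [|[|[|[|[|[|[|//]]]]]]] // ox _ _.
- by move/eqP: ox; rewrite order_eq1 => /eqP->; rewrite expg1n !inE eqxx orbT.
- by rewrite -ox expg_order !inE eqxx orbT.
- have TI : <[x]> :&: <[g]> = 1.
    by apply: prime_TIg; rewrite ?cycle_subG // -orderE ox.
  have := mul_cardG <[x]> <[g]>; rewrite TI cards1 muln1 -!orderE ox og.
  have /subset_leq_card : <[x]> * <[g]> \subset G by rewrite mul_subG ?cycle_subG.
  by rewrite oG => le6 e9; rewrite -e9 in le6.
- case/negP: nabG; apply: cyclic_abelian; apply/cyclicP; exists x.
  by apply/esym/eqP; rewrite eqEcard cycle_subG Gx -orderE oG ox.
Qed.

(** This trades the isomorphism type for a condition inside G that matches the avoidance property.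
    Conversely, g is central because its conjugates are nontrivial and equal to their own k-th
    powers; a complement to <g> is then a direct factor. *)
Lemma odd_direct_product_caseP :
  odd_direct_product_case G k <->
  odd k /\ exists g, [/\ g \in G, #[g] = 2
                       & forall x, x \in G -> x ^+ k \in [set 1; g]].
Proof.
split=> [[ok [hT [H [expH isoG]]]] | [ok [g [Gg og pwG]]]]; split=> //.
  have /isogP[f injf imf] := isog_symr isoG.
  (* The involution generating the [Zp 2] factor; k-th powers have trivial component in H. *)
  pose z : hT * 'Z_2 := (1, Zp1).
  have Hz : z \in setX H (Zp 2) by rewrite in_setX group1 inE.
  exists (f z); split; first by rewrite -imf mem_morphim.
    rewrite (order_injm injf) //; apply: nt_prime_order => //.
      by rewrite expg_pair expg1n; congr pair; apply: val_inj.
    by apply/eqP=> -[].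
  move=> x; rewrite -imf => /morphimP[[a b] Hab _ ->].
  have [Ha _] := setXP Hab.
  rewrite -morphX // expg_pair (exponentP expH) //.
  have [->|->] := Z2_cases (b ^+ k); first by rewrite morph1 !inE eqxx.
  by rewrite !inE eqxx orbT.
have sgG : <[g]> \subset G by rewrite cycle_subG.
have defZ : <[g]> = [set 1; g] by apply: cycle2g.
have cgG : g \in 'Z(G).
  apply/centerP; split=> // y Gy; apply/commgP/conjg_fixP.
  have gk : g ^+ k = g.
    have [|//] := set2P (pwG _ Gg).
    by move/eqP; rewrite -order_dvdn og dvdn2 ok.
  have := pwG _ (groupJ Gg Gy); rewrite -conjXg gk !inE conjg_eq1.
  by rewrite -order_eq1 og => /eqP.
have nZG : <[g]> <| G.
  by rewrite sub_center_normal // cycle_subG.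
have hallZ : Hall G <[g]>.
  (* An involution of G / <g> would be killed by the odd exponent k. *)
  rewrite /Hall sgG -orderE og coprime2n -[odd _]negbK -dvdn2.
  rewrite -card_quotient ?normal_norm //; apply/negP=> dv2.
  have [_ /morphimP[x Nx Gx ->] oxZ] := Cauchy (isT : prime 2) dv2.
  have: coset <[g]> x ^+ k == 1.
    by rewrite -morphX //; apply/eqP/coset_id; rewrite defZ pwG.
  by rewrite -order_dvdn oxZ dvdn2 ok.
have /splitsP[H /complP[TI defG]] := SchurZassenhaus_split hallZ nZG.
have sHG : H \subset G by rewrite -defG mulG_subr.
exists gT, H; split.
  (* A k-th power of an element of H lies in both H and <g>, which meet trivially. *)
  apply/exponentP=> x Hx; apply/eqP; rewrite -in_set1 -set1gE -TI in_setI (groupX k Hx) andbT.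
  by rewrite /= defZ pwG // (subsetP sHG).
have dG : H \x <[g]> = G.
  rewrite dprodE 1?setIC //.
    by rewrite (normC (subset_trans sHG (normal_norm nZG))).
  rewrite cycle_subG; apply: subsetP cgG.
  by rewrite subIset // centS ?orbT.
apply: isog_dprod dG (setX_dprod H [group of Zp 2]) (isog_setX1 _ _) _.
by apply: isog_trans (isog_set1X _ _); rewrite isog_sym -og Zp_isog.
Qed.

(** With Z = {1, g}, the powers x^k all lie in Z exactly when G / Z has exponent dividing k. *)
Lemma central_extension_caseP :
  central_extension_case G k <->
  [/\ ~~ odd k, ~~ (exponent G %| k)
    & exists g, [/\ #[g] = 2, g \in 'Z(G)
                  & forall x, x \in G -> x ^+ k \in [set 1; g]]].
Proof.
split=> [[ek [hT [H [Z [expH sZ oZ isoH]]]] expG] | [ek expG [g [og Zg pwG]]]].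
  split=> //.
  have [g Zg og] : {g | g \in Z & #[g] = 2} by apply: Cauchy; rewrite ?oZ.
  exists g; split=> // [|x Gx]; first exact: subsetP Zg.
  have nZG := normal_norm (sub_center_normal sZ).
  have -> : [set 1; g] = Z.
    by rewrite -(cycle2g og); apply/eqP; rewrite eqEcard cycle_subG Zg oZ -orderE og.
  apply: coset_idr; first by rewrite groupX // (subsetP nZG).
  rewrite morphX ?(subsetP nZG) //.
  by move: expH; rewrite -(exponent_isog isoH) => /exponentP-> //; apply: mem_quotient.
split=> //; exists (coset_of <[g]>), (G / <[g]>)%G, <[g]>%G.
have sZ : <[g]> \subset 'Z(G) by rewrite cycle_subG.
have nZG := normal_norm (sub_center_normal sZ).
split=> //; last exact: isog_refl.
apply/exponentP=> _ /morphimP[x Nx Gx ->].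
by rewrite -morphX //; apply: coset_id; rewrite (cycle2g og) pwG.
Qed.

End Converse.

Theorem theorem7 (gT : finGroupType) (G : {group gT}) (k : nat)
    (k_gt0 : 0 < k) :
  [/\ power_avoiding_max G k + 2 = #|G| <->
        [\/ odd_direct_product_case G k, cyclic3_case G k,
            dihedral6_case G k | central_extension_case G k],
      odd_direct_product_case G k ->
        exists g : gT,
          [/\ g \in G, #[g] = 2,
              forall h : gT, h \in G -> #[h] = 2 -> h = g
            & power_avoiding G k (G :\: [set 1; g])],
      cyclic3_case G k ->
        forall g : gT, g \in G -> g != 1 ->
          power_avoiding G k [set g] /\ #|[set g]| + 2 = #|G|,
      dihedral6_case G k ->
        forall g : gT, g \in G -> #[g] = 3 ->
          power_avoiding G k (G :\: [set 1; g])
    & central_extension_case G k ->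
        exists g : gT,
          [/\ #[g] = 2, g \in 'Z(G)
            & power_avoiding G k (G :\: [set 1; g])]].
Proof.
have exp_order g : g \in G -> ~~ (#[g] %| k) -> ~~ (exponent G %| k).
  by move=> Gg; apply: contra; apply: dvdn_trans; apply: dvdn_exponent.
split.
- apply: (iff_trans (power_avoiding_maxE G k)); split=> [[expG [g [Gg g1 avg]]] | ].
    have [moved | fixed] := boolP (g ^+ k \notin [set 1; g]).
      by case: (moved_cases Gg g1 avg moved); [constructor 2 | constructor 3].
    have pwG x : x \in G -> x ^+ k \in [set 1; g].
      move=> Gx; have [-> | xg] := eqVneq x g; first by rewrite negbK in fixed.
      exact: avoiding_powers avg _ Gx xg.
    have /set2P[gk | gk] := pwG g Gg.
      have [og Zg ek] := avoiding_trivial Gg g1 avg expG gk.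
      by constructor 4; apply/central_extension_caseP; split=> //; exists g.
    have [og ok] := avoiding_fixed Gg g1 avg gk.
    by constructor 1; apply/odd_direct_product_caseP; split=> //; exists g.
  case=> [/odd_direct_product_caseP[ok [g [Gg og pwG]]] | c3 | d6 |
          /central_extension_caseP[ek expG [g [og Zg pwG]]]].
  + split; first by apply: (exp_order g) => //; rewrite og dvdn2 ok.
    exists g; split=> //; last exact: powers_in_pair_avoiding.
    by rewrite -order_gt1 og.
  + have [k2 _ oG] := c3.
    have [g Gg og] : {g | g \in G & #[g] = 3} by apply: Cauchy; rewrite ?oG.
    have g1 : g != 1 by rewrite -order_gt1 og.
    split; first by apply: (exp_order g) => //; rewrite og /dvdn k2.
    by exists g; split=> //; case: (cyclic3_avoiding c3 Gg g1).
  + have [k2 /dihedral6P[oG _]] := d6.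
    have [g Gg og] : {g | g \in G & #[g] = 3} by apply: Cauchy; rewrite ?oG.
    split; last first.
      exists g; split=> //; last exact: dihedral6_avoiding.
      by rewrite -order_gt1 og.
    apply: (exp_order g) => //; rewrite order_dvdn.
    by rewrite (expg_mod_cardG (n := 2) Gg) ?oG // -order_dvdn og.
  + split=> //; exists g; split; last exact: powers_in_pair_avoiding.
    * exact: subsetP (center_sub G) _ Zg.
    * by rewrite -order_gt1 og.
- case/odd_direct_product_caseP=> ok [g [Gg og pwG]].
  exists g; split=> // [h Gh oh|]; last exact: powers_in_pair_avoiding.
  (* Uniqueness: an involution equals its own odd power, so it lies in {1, g}. *)
  have hk : h ^+ k = h.
    by rewrite (divn_eq k 2) modn2 ok expgD mulnC expgM -oh expg_order expg1n mul1g.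
  have := pwG h Gh; rewrite hk => /set2P[] // h1.
  by move: oh; rewrite h1 order1.
- move=> c3 g Gg g1; have [k2 _ oG] := c3; rewrite cards1 oG; split=> //.
  have [og _] := cyclic3_avoiding c3 Gg g1.
  rewrite /power_avoiding sub1set Gg; apply/forall_inP=> x Gx.
  (* Only x = g could violate avoidance, and g^k = g^2 differs from g because g has order 3. *)
  rewrite subUset !sub1set !inE; apply/negP=> /andP[/eqP-> ].
  rewrite (expg_mod_cardG (n := 2) Gg) ?oG // -{2}[g]expg1.
  by rewrite eq_expg_mod_order og.
- by move=> d6 g; apply: dihedral6_avoiding.
case/central_extension_caseP=> ek expG [g [og Zg pwG]].
by exists g; split=> //; apply: powers_in_pair_avoiding.
Qed.
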